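(* For every positive integer $k$ and every graph $G$ of order greater than $1$, we have $\textnormal{ftdim}_k(G) \le \dim_k(G)\,(2+3^{\dim_k(G)-1})$.
   Context: Graphs are finite, simple, undirected, possibly disconnected; $\textnormal{dist}(u,v)=\infty$ between different components. For a positive integer $k$, a set $S=\{v_1,\dots,v_j\}$ of vertices is a $k$-truncated resolving set ($k$-resolving set) of $G$ if the vectors $(\min(k+1,\textnormal{dist}(u,v_1)),\dots,\min(k+1,\textnormal{dist}(u,v_j)))$ are pairwise distinct over $u\in V(G)$. The $k$-truncated metric dimension $\dim_k(G)$ is the minimum size of a $k$-resolving set. $\textnormal{ftdim}_k(G)$ is the minimum size of a nonempty $S\subseteq V(G)$ such that $S-\{s\}$ is a $k$-resolving set for every $s\in S$. *)

(* Defs.v *)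
From mathcomp Require Import all_boot.

Set Implicit Arguments.
Unset Strict Implicit.
Unset Printing Implicit Defensive.

(* A finite simple graph is given by a finite vertex type T with a symmetric
   irreflexive adjacency relation e. *)
Section Graph.

Variables (T : finType) (e : rel T).

Definition walk (n : nat) (u v : T) : bool :=
  [exists p : n.-tuple T, path e u p && (last u p == v)].

Lemma walkP n u v :
  reflect (exists p : seq T, [/\ size p = n, path e u p & last u p = v])
          (walk n u v).
Proof.
apply: (iffP existsP) => [[p /andP[ep /eqP lp]]|[p [sp ep lp]]].
  by exists p; rewrite size_tuple.
move/eqP: sp => sp; exists (Tuple sp); rewrite /= ep; exact/eqP.
Qed.

Lemma connect_walk u v : connect e u v -> exists n, walk n u v.
Proof.
by case/connectP=> p ep ->; exists (size p); apply/walkP; exists p.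
Qed.

(* None encodes an infinite distance. *)
Definition dist (u v : T) : option nat :=
  match @idP (connect e u v) with
  | ReflectT uv => Some (ex_minn (connect_walk uv))
  | ReflectF _ => None
  end.

Lemma dist_Some u v d :
  dist u v = Some d <-> walk d u v /\ (forall n, walk n u v -> d <= n).
Proof.
rewrite /dist; case: {-}_ / idP => [uv|nuv].
  case: ex_minnP => m wm minm; split=> [[<-]//|[wd mind]].
  by congr Some; apply/eqP; rewrite eqn_leq minm // mind.
split=> // -[/walkP[p [_ ep lp]] _].
by case: nuv; apply/connectP; exists p.
Qed.

Lemma dist_None u v : dist u v = None <-> ~~ connect e u v.
Proof. by rewrite /dist; case: {-}_ / idP => [uv|/negP]; rewrite ?uv. Qed.

Definition tdist (k : nat) (u v : T) : nat :=
  if dist u v is Some d then minn k.+1 d else k.+1.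

Definition resolving (k : nat) (S : {set T}) : bool :=
  injectiveb (fun u => [seq tdist k u v | v in S]).

Definition ft_resolving (k : nat) (S : {set T}) : bool :=
  (S != set0) && [forall s in S, resolving k (S :\ s)].

(* The default value setT of the minimum is admissible by resolving_setT. *)
Definition dimk (k : nat) : nat :=
  #|[arg min_(S < [set: T] | resolving k S) #|S|]|.

(* The default value setT is admissible, by ft_resolving_setT, as soon as the
   graph has a vertex; on the null graph no set is admissible and ftdimk is 0. *)
Definition ftdimk (k : nat) : nat :=
  #|[arg min_(S < [set: T] | ft_resolving k S) #|S|]|.

Lemma tdist_eq0 k u v : (tdist k u v == 0) = (u == v).
Proof.
rewrite /tdist; case E: (dist u v) => [d|]; last first.
  by move/dist_None: E; case: (u =P v) => // ->; rewrite connect0.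
have [/walkP[p [sp _ lp]] mind] := (dist_Some u v d).1 E.
apply/eqP/eqP => [|uv].
  case: d sp {E mind} => [/size0nil p0 _|d _]; first by rewrite -lp p0.
  by rewrite minnSS.
have: walk 0 u v by apply/walkP; exists [::].
by move/mind; rewrite leqn0 => /eqP ->; rewrite minn0.
Qed.

Lemma resolvingP k (S : {set T}) :
  reflect (forall u w, {in S, forall v, tdist k u v = tdist k w v} -> u = w)
          (resolving k S).
Proof.
apply: (iffP (injectiveP _)) => H u w uw.
  by apply: H; apply/eq_in_map => v; rewrite mem_enum => /uw.
by apply: H => v vS; move/eq_in_map: uw; apply; rewrite mem_enum.
Qed.

Lemma resolving_setT k : resolving k [set: T].
Proof.
apply/resolvingP => u w /(_ w (in_setT w)) E.
by apply/eqP; rewrite -(tdist_eq0 k) E tdist_eq0.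
Qed.

Lemma ft_resolving_setT k : 0 < #|T| -> ft_resolving k [set: T].
Proof.
rewrite -cardsT card_gt0 /ft_resolving => -> /=.
apply/forall_inP => s _; apply/resolvingP => u w E.
have [us|us] := eqVneq u s; last first.
  have /E/eqP : u \in [set: T] :\ s by rewrite !inE us.
  by rewrite (eqP (etrans (tdist_eq0 k u u) (eqxx u))) eq_sym tdist_eq0 => /eqP.
have [ws|ws] := eqVneq w s; first by rewrite us ws.
have /E/eqP : w \in [set: T] :\ s by rewrite !inE ws.
by rewrite (eqP (etrans (tdist_eq0 k w w) (eqxx w))) tdist_eq0 => /eqP.
Qed.

Lemma dimkP k :
  (exists2 S, resolving k S & #|S| = dimk k) /\
  (forall S, resolving k S -> dimk k <= #|S|).
Proof.
rewrite /dimk; case: arg_minnP => [|S rS minS]; first exact: resolving_setT.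
by split=> //; exists S.
Qed.

Lemma ftdimkP k : 0 < #|T| ->
  (exists2 S, ft_resolving k S & #|S| = ftdimk k) /\
  (forall S, ft_resolving k S -> ftdimk k <= #|S|).
Proof.
move=> T0; rewrite /ftdimk; case: arg_minnP => [|S rS minS].
  exact: ft_resolving_setT.
by split=> //; exists S.
Qed.

End Graph.

(* Main.v *)
Require Import Defs.
From mathcomp Require Import all_boot.

Set Implicit Arguments.
Unset Strict Implicit.

(** Let S be a minimum k-resolving set. Enlarge S by adding, for every s in S,
    all neighbours of s and the "twins" of s: the vertices w <> s that no vertex
    of S or N(s) other than s separates from s. If s separates u and w, with u
    the closer one and u <> s, then the last vertex before s on a geodesic from
    u to s also separates them; and s itself is separated from every w by S, by
    N(s) or, when w is a twin, by w. So s may be removed. The distances from a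
    neighbour of s to the rest of S differ by at most 1 from those of s, so s
    has at most 3 ^ (#|S| - 1) neighbours. All twins of s lie at the same
    truncated distance from s (2, or k + 1 if s is isolated), hence there is at
    most one, and each s accounts for at most 1 + 3 ^ (#|S| - 1) + 1 vertices. *)

Section TruncatedDistance.

Variables (T : finType) (e : rel T) (k : nat).
Hypothesis e_sym : symmetric e.

Lemma walk_sym n u v : walk e n u v = walk e n v u.
Proof.
suff sub x y : walk e n x y -> walk e n y x by apply/idP/idP; apply: sub.
case/walkP=> p [sp ep <-]; apply/walkP; exists (rev (belast x p)); split.
- by rewrite size_rev size_belast.
- rewrite rev_path; apply: sub_path ep => a b; by rewrite e_sym.
- by case: p {sp ep} => //= a p; rewrite rev_cons last_rcons.
Qed.

Lemma tdist_le u v : tdist e k u v <= k.+1.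
Proof. by rewrite /tdist; case: dist => // d; rewrite geq_minl. Qed.

Lemma tdistxx u : tdist e k u u = 0.
Proof. by apply/eqP; rewrite tdist_eq0. Qed.

(** Values up to [k] are not affected by truncation, so such bounds reduce to walks, without regard
    to connectedness. *)
Lemma tdist_leP j u v : j <= k ->
  reflect (exists2 n, n <= j & walk e n u v) (tdist e k u v <= j).
Proof.
move=> jk; rewrite /tdist; case E: (dist e u v) => [d|].
  have [wd mind] := (dist_Some e u v d).1 E.
  rewrite geq_min [k < j]ltnNge jk /=; apply: (iffP idP) => [dj|[n nj /mind]].
    by exists d.
  by move=> dn; apply: leq_trans nj.
rewrite ltnNge jk; constructor => -[n _ /walkP[p [_ ep lp]]].
by move/dist_None/negP: E; apply; apply/connectP; exists p.
Qed.

Lemma tdist_sym u v : tdist e k u v = tdist e k v u.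
Proof.
suff sub x y : tdist e k x y <= tdist e k y x.
  by apply/eqP; rewrite eqn_leq !sub.
have [jk|kj] := leqP (tdist e k y x) k; last first.
  exact: leq_trans (tdist_le _ _) kj.
have /(tdist_leP _ _ jk)[n nj w] := leqnn (tdist e k y x).
by apply/(tdist_leP _ _ jk); exists n; rewrite // walk_sym.
Qed.

Lemma tdist_edge_l x y v : e x y -> tdist e k x v <= (tdist e k y v).+1.
Proof.
move=> exy; have [jk|kj] := ltnP (tdist e k y v) k; last first.
  exact: leq_trans (tdist_le _ _) _.
have /(tdist_leP _ _ (ltnW jk))[n nj /walkP[p [sp ep lp]]] :=
  leqnn (tdist e k y v).
apply/(tdist_leP _ _ jk); exists n.+1 => //.
by apply/walkP; exists (y :: p); rewrite /= sp exy.
Qed.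

Lemma tdist_edge_r x y v : e x y -> tdist e k v x <= (tdist e k v y).+1.
Proof. by rewrite !(tdist_sym v); apply: tdist_edge_l. Qed.

(** [x] is the last vertex before [v] on a shortest walk from [u]. The bound [k] matters: in the
    truncated range both values could be [k.+1]. *)
Lemma tdist_penultimate u v : u != v -> tdist e k u v <= k ->
  exists2 x, e v x & tdist e k u x < tdist e k u v.
Proof.
move=> uv jk; have /(tdist_leP _ _ jk)[n nj] := leqnn (tdist e k u v).
case/walkP=> p; case/lastP: p => [[_ _ /= uEv]|p x];
  first by rewrite uEv eqxx in uv.
rewrite size_rcons rcons_path last_rcons => -[sp /andP[ep ex] xv].
rewrite xv in ex; rewrite -sp in nj.
exists (last u p); first by rewrite e_sym.
apply: leq_trans (nj); rewrite ltnS; apply/tdist_leP; last first.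
  by exists (size p) => //; apply/walkP; exists p.
exact: ltnW (leq_trans nj jk).
Qed.

End TruncatedDistance.

Section Twins.

Variables (T : finType) (e : rel T) (k : nat) (S : {set T}).
Hypotheses (k_gt0 : 0 < k) (e_sym : symmetric e) (e_irr : irreflexive e).
Hypothesis resS : resolving e k S.

Definition nbhd (s : T) : {set T} := [set x | e s x].

Definition twins (s : T) : {set T} :=
  [set w | (w != s) &&
     [forall v in (S :|: nbhd s) :\ s, tdist e k w v == tdist e k s v]].

Lemma twinsP s w :
  reflect (w != s /\
           {in (S :|: nbhd s) :\ s, forall v, tdist e k w v = tdist e k s v})
          (w \in twins s).
Proof.
rewrite inE; apply: (iffP andP) => -[ws H]; split=> //.
  by move=> v /(forall_inP H)/eqP.
by apply/forall_inP => v /H ->.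
Qed.

Lemma neighbor_neq s x : e s x -> x != s.
Proof. by apply: contraTneq => ->; rewrite e_irr. Qed.

Lemma tdist_neighbor s x : e s x -> tdist e k x s = 1.
Proof.
move=> esx; apply/eqP; rewrite eqn_leq lt0n tdist_eq0 neighbor_neq // andbT.
by rewrite -[1]/(0.+1) -(tdistxx e k s) tdist_edge_l // e_sym.
Qed.

Lemma tdist_twin s w : w \in twins s ->
  tdist e k w s = if nbhd s == set0 then k.+1 else 2.
Proof.
case/twinsP=> ws tw.
have tw_nbr x : e s x -> tdist e k w x = 1.
  move=> esx; rewrite tw ?(tdist_sym k e_sym s) ?tdist_neighbor //.
  by rewrite !inE esx orbT neighbor_neq.
(* Otherwise, as [1 <= k], some neighbour of [s] would be at distance 0 from [w], whereas a twin is
   at distance 1 from each of them. *)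
have gt1 : 1 < tdist e k w s.
  rewrite ltnNge; apply/negP => le1.
  have [x /tw_nbr wx1 ltx] := tdist_penultimate e_sym ws (leq_trans le1 k_gt0).
  by rewrite wx1 ltnNge le1 in ltx.
case: eqP => [N0|/eqP/set0Pn[x]].
  apply/eqP; rewrite eqn_leq tdist_le ltnNge /=; apply/negP.
  case/(tdist_penultimate e_sym ws) => x esx _.
  by have := in_set0 x; rewrite -N0 inE esx.
rewrite inE => esx; apply/eqP; rewrite eqn_leq gt1 andbT.
by rewrite -[2]/(1.+1) -(tw_nbr x) // tdist_edge_r.
Qed.

(** Two twins both agree with [s] on the rest of [S], and [tdist_twin] makes them agree at [s] too,
    so [S] would not separate them. *)
Lemma card_twins s : #|twins s| <= 1.
Proof.
apply/card_le1_eqP => w w' tww tww'; apply: (resolvingP _ _ _ resS) => v vS.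
have [->|vs] := eqVneq v s; first by rewrite !tdist_twin.
have vD : v \in (S :|: nbhd s) :\ s by rewrite !inE vs vS.
have [[_ tw] [_ tw']] := (twinsP _ _ tww, twinsP _ _ tww').
by rewrite tw ?tw'.
Qed.

Lemma card_nbhd s : s \in S -> #|nbhd s| <= 3 ^ (#|S| - 1).
Proof.
move=> sS.
(* The difference of the two distances is -1, 0 or 1; adding 1 first codes it as 0, 1 or 2 and keeps
   the natural subtraction exact. *)
pose shift x v := tdist e k x v + 1 - tdist e k s v.
have lip x v : e s x ->
    tdist e k s v <= (tdist e k x v).+1 /\ tdist e k x v <= (tdist e k s v).+1.
  by move=> esx; split; apply: tdist_edge_l; rewrite // e_sym.
have shift_lt3 x v : e s x -> shift x v < 3.
  by case/(lip x v)=> _ le; rewrite /shift addn1 ltnS leq_subLR addn2 ltnS.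
(* The default [ord0] off [S :\ s] places [f x] in a [pffun_on] family with [3 ^ #|S :\ s|]
   members. *)
pose f x : {ffun T -> 'I_3} :=
  [ffun v => if v \in S :\ s then inord (shift x v) else ord0].
have f_inj : {in nbhd s &, injective f}.
  move=> x y; rewrite !inE => esx esy fxy; apply: (resolvingP _ _ _ resS) => v vS.
  have [->|vs] := eqVneq v s; first by rewrite !tdist_neighbor.
  move/ffunP/(_ v): fxy; rewrite !ffunE !inE vs vS /= => /(congr1 val) /=.
  rewrite !inordK ?shift_lt3 // /shift !addn1.
  have [lex _] := lip x v esx; have [ley _] := lip y v esy.
  move/(congr1 (addn^~ (tdist e k s v))).
  by rewrite /= !subnK // => -[].
rewrite -(card_in_imset f_inj) (cardsD1 s S) sS addKn.
have <- : #|pffun_on (ord0 : 'I_3) (mem (S :\ s)) predT| = 3 ^ #|S :\ s|.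
  by rewrite card_pffun_on card_ord.
apply/subset_leq_card/subsetP => _ /imsetP[x _ ->].
apply/pffun_onP; split=> //; apply/subsetP => v.
by rewrite inE /= ffunE; case: ifP => //; rewrite eqxx.
Qed.

Definition closed_nbhd_twins (s : T) : {set T} := s |: (nbhd s :|: twins s).

Definition fault_tolerant_hull : {set T} := \bigcup_(s in S) closed_nbhd_twins s.

Lemma card_fault_tolerant_hull :
  #|fault_tolerant_hull| <= #|S| * (2 + 3 ^ (#|S| - 1)).
Proof.
apply: (@leq_trans (\sum_(s in S) #|closed_nbhd_twins s|)).
  rewrite /fault_tolerant_hull.
  elim/big_rec2: _ => [|s n A _ leA]; first by rewrite cards0.
  by rewrite (leq_trans (leq_card_setU _ _)) // leq_add2l.
rewrite -sum_nat_const; apply: leq_sum => s sS.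
rewrite (leq_trans (leq_card_setU _ _)) // cards1 -[2]/(1 + 1) -addnA leq_add2l.
rewrite (leq_trans (leq_card_setU _ _)) // addnC.
by rewrite leq_add ?card_twins ?card_nbhd.
Qed.

Lemma sub_fault_tolerant_hull s :
  s \in S -> {subset closed_nbhd_twins s <= fault_tolerant_hull}.
Proof. by move=> sS x xs; apply/bigcupP; exists s. Qed.

Lemma subset_fault_tolerant_hull : {subset S <= fault_tolerant_hull}.
Proof. by move=> s sS; apply: (sub_fault_tolerant_hull sS); rewrite setU11. Qed.

Lemma resolving_fault_tolerant_hullD1 t :
  resolving e k (fault_tolerant_hull :\ t).
Proof.
apply/resolvingP => u w uw.
have uwS v : v \in S -> v != t -> tdist e k u v = tdist e k w v.
  by move=> vS vt; apply: uw; rewrite !inE vt subset_fault_tolerant_hull.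
have [tS|tS] := boolP (t \in S); last first.
  apply: (resolvingP _ _ _ resS) => v vS; apply: uwS => //.
  by apply: contraNneq tS => <-.
have uwN v : e t v -> tdist e k u v = tdist e k w v.
  move=> etv; apply: uw; rewrite !inE neighbor_neq //=.
  by apply: (sub_fault_tolerant_hull tS); rewrite !inE etv orbT.
(* All the hypotheses are symmetric in [u] and [w], so [u] may be taken as the one closer to [t]. *)
wlog le_uw : u w uw uwS uwN / tdist e k u t <= tdist e k w t.
  move=> H; have [|/ltnW] := leqP (tdist e k u t) (tdist e k w t); first exact: H.
  by move=> le; symmetry; apply: H le => v *; symmetry; [apply: uw|apply: uwS|apply: uwN].
have [eq_uw|neq_uw] := eqVneq (tdist e k u t) (tdist e k w t).
  apply: (resolvingP _ _ _ resS) => v vS.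
  by have [->|vt] := eqVneq v t; last exact: uwS.
have lt_uw : tdist e k u t < tdist e k w t by rewrite ltn_neqAle neq_uw.
have [ut|ut] := eqVneq u t; last first.
  have uk : tdist e k u t <= k by rewrite -ltnS (leq_trans lt_uw) ?tdist_le.
  have [x etx] := tdist_penultimate e_sym ut uk.
  (* [w] is as close to [x] as [u] is, so going through [x] brings [w] within [tdist e k u t] of
     [t], contradicting [lt_uw]. *)
  rewrite uwN // => /(leq_trans (tdist_edge_r k e_sym w etx)).
  by rewrite leqNgt lt_uw.
subst u; have [<-//|wt] := eqVneq w t.
(* Now [u] is [t], and [w] is a twin of it. Hence [w] lies in the hull without [t], where its
   distance 0 to itself forces equality. *)
have tw : w \in twins t.
  apply/twinsP; split=> // v; rewrite !inE => /andP[vt /orP[vS|etv]].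
    by rewrite uwS.
  by rewrite uwN.
apply/eqP; rewrite -(tdist_eq0 e k) uw ?tdistxx //.
rewrite in_setD1 wt; apply: (sub_fault_tolerant_hull tS).
by rewrite in_setU1 in_setU tw !orbT.
Qed.

End Twins.

Theorem theorem23 (k : nat) (T : finType) (e : rel T) (k_gt0 : 0 < k)
    (e_sym : symmetric e) (e_irr : irreflexive e) (T_gt1 : 1 < #|T|) :
  ftdimk e k <= dimk e k * (2 + 3 ^ (dimk e k - 1)).
Proof.
have [[S resS <-] _] := dimkP e k.
have [_ ftdim_min] := ftdimkP e k (ltnW T_gt1).
apply: leq_trans (card_fault_tolerant_hull k_gt0 e_sym e_irr resS).
apply: ftdim_min; rewrite /ft_resolving; apply/andP; split; last first.
  by apply/forall_inP => t _; apply: resolving_fault_tolerant_hullD1.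
have [S0|/set0Pn[s sS]] := eqVneq S set0; last first.
  by apply/set0Pn; exists s; apply: subset_fault_tolerant_hull.
(* An empty [S] separates nothing, so it cannot resolve two distinct vertices. *)
case/card_gt1P: T_gt1 => x [y [_ _ /eqP[]]].
by apply: (resolvingP _ _ _ resS) => v; rewrite S0 inE.
Qed.
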